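(* Let $q>0$, $q\ne1$, $M\ge1$, $\vec N=(N_1,\dots,N_M)\in(\mathbb{Z}_{\ge0})^M$, $s,t\in\mathbb{R}$ and $v\in\mathbb{C}$. Then for all $\vec y,\vec y\,'\in\prod_j\{0,\dots,N_j\}$, $$\sum_{x_1=0}^{N_1}\cdots\sum_{x_M=0}^{N_M}R_{\mathrm r}(\vec x,\vec y;s,t,v,\vec N)\,\overline{R_{\mathrm r}(\vec x,\vec y\,';s,t,-\overline v-2,\vec N)}\,W(\vec x,s;q^{-1})=\frac{\delta_{\vec y,\vec y\,'}}{W(\vec y,t;q^{-1})},$$ and for all $\vec x,\vec x\,'\in\prod_j\{0,\dots,N_j\}$, $$\sum_{y_1=0}^{N_1}\cdots\sum_{y_M=0}^{N_M}R_{\mathrm r}(\vec x,\vec y;s,t,v,\vec N)\,\overline{R_{\mathrm r}(\vec x\,',\vec y;s,t,-\overline v-2,\vec N)}\,W(\vec y,t;q^{-1})=\frac{\delta_{\vec x,\vec x\,'}}{W(\vec x,s;q^{-1})}.$$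
   Context: $q^z=e^{z\log q}$; $(\alpha;p)_n=\prod_{i=0}^{n-1}(1-\alpha p^i)$, $(\alpha_1,\dots,\alpha_m;p)_n=\prod_i(\alpha_i;p)_n$; $\begin{bmatrix}N\\ n\end{bmatrix}_{p}=\frac{(p;p)_N}{(p;p)_n(p;p)_{N-n}}$. For $N\in\mathbb{Z}_{\ge0}$, $u,s\in\mathbb{C}$, $n,x\in\{0,\dots,N\}$, $$k_{u,s}(n,x;N)=(-1)^nq^{n(s-u-\frac12N+\frac12)}\sum_{j=0}^{\min(n,x)}\frac{(q^{2n},\,q^{2x},\,-q^{-2x-2s+2N};q^{-2})_j}{(q^{2N},\,q^{-2};q^{-2})_j}q^{-2j},\qquad w(n;N)=q^{n(n-N)}\begin{bmatrix}N\\ n\end{bmatrix}_{q^2},$$ and for a base $p>0$, $p\ne1$, $$W(x,s,N;p)=\frac{1+p^{4x+2s-2N}}{1+p^{2s-2N}}\,\frac{(-p^{2s-2N};p^2)_x}{(-p^{2s+2};p^2)_x}\,\frac{p^{-x(2s+1+x-2N)}}{(-p^{-2s};p^2)_N}\begin{bmatrix}N\\ x\end{bmatrix}_{p^2}.$$ Height function: $h_j(\vec y,t)=t+\sum_{i=1}^j(2y_i-N_i)$, $h_0(\vec y,t)=t$. Then $$K_{v,t}(\vec n,\vec y)=\prod_{j=1}^M k_{v,h_{j-1}(\vec y,t)}(n_j,y_j;N_j),\quad w(\vec n)=\prod_{j=1}^Mw(n_j;N_j),\quad W(\vec x,s;q^{-1})=\prod_{j=1}^M W(x_j,h_{j-1}(\vec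 x,s),N_j;q^{-1}),$$ $$R_{\mathrm r}(\vec x,\vec y;s,t,v,\vec N)=\sum_{n_1=0}^{N_1}\cdots\sum_{n_M=0}^{N_M}K_{1,s}(\vec n,\vec x)\,K_{v,t}(\vec n,\vec y)\,w(\vec n).$$ *)

(* Defs.v *)
From HB Require Import structures.
From mathcomp Require Import all_boot all_order all_algebra.
From mathcomp Require Import complex.
From mathcomp Require Import reals sequences exp trigo.

Set Implicit Arguments.
Unset Strict Implicit.
Unset Printing Implicit Defensive.

Import Order.TTheory GRing.Theory Num.Theory.

Local Open Scope complex_scope.
Local Open Scope ring_scope.

Definition cexp (R : realType) (z : R[i]) : R[i] :=
  (expR (complex.Re z) * cos (complex.Im z))
  +i* (expR (complex.Re z) * sin (complex.Im z)).

(* Meant for p > 0 only, since ln is 0 outside the positive reals. *)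
Definition cpow (R : realType) (p : R) (z : R[i]) : R[i] :=
  cexp (z * (ln p)%:C).

Local Notation "p ^^ z" := (cpow p z) (at level 30, right associativity).

Definition qpoch (F : fieldType) (a p : F) (n : nat) : F :=
  \prod_(i < n) (1 - a * p ^+ i).

Definition qpochs (F : fieldType) (s : seq F) (p : F) (n : nat) : F :=
  \prod_(a <- s) qpoch a p n.

(* Meant for n <= N. *)
Definition qbinom (F : fieldType) (p : F) (N n : nat) : F :=
  qpoch p p N / (qpoch p p n * qpoch p p (N - n)).

Definition krav (R : realType) (q : R) (u s : R[i]) (n x N : nat) : R[i] :=
  (-1) ^+ n * q ^^ (n%:R * (s - u - 2^-1 * N%:R + 2^-1)) *
  \sum_(j < (minn n x).+1)
    qpochs [:: q ^^ (2 * n%:R); q ^^ (2 * x%:R);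
               - q ^^ (- 2 * x%:R - 2 * s + 2 * N%:R)] (q ^^ (- 2)) j /
    qpochs [:: q ^^ (2 * N%:R); q ^^ (- 2)] (q ^^ (- 2)) j *
    q ^^ (- 2 * j%:R).

Definition wgt (R : realType) (q : R) (n N : nat) : R[i] :=
  q ^^ (n%:R * (n%:R - N%:R)) * qbinom (q ^^ 2) N n.

Definition Wgt (R : realType) (p : R) (x : nat) (s : R[i]) (N : nat) : R[i] :=
  (1 + p ^^ (4 * x%:R + 2 * s - 2 * N%:R)) / (1 + p ^^ (2 * s - 2 * N%:R)) *
  (qpoch (- p ^^ (2 * s - 2 * N%:R)) (p ^^ 2) x /
   qpoch (- p ^^ (2 * s + 2)) (p ^^ 2) x) *
  (p ^^ (- x%:R * (2 * s + 1 + x%:R - 2 * N%:R)) /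
   qpoch (- p ^^ (- 2 * s)) (p ^^ 2) N) *
  qbinom (p ^^ 2) N x.

(* The box {0..N_1} x ... x {0..N_M}; coordinates are indexed from 0. *)
Notation box N := {dffun forall j, 'I_(N j).+1}.

Section Multivariate.
Variables (R : realType) (q : R) (M : nat) (N : 'I_M -> nat).

Definition height (y : box N) (t : R[i]) (k : nat) : R[i] :=
  t + \sum_(i < M | (i < k)%N) (2 * (y i)%:R - (N i)%:R).

(* The 0-based coordinate j is the 1-based coordinate j + 1, so the height
   h_{(j + 1) - 1} attached to it is height y t j. *)
Definition Kmul (v t : R[i]) (n y : box N) : R[i] :=
  \prod_(j < M) krav q v (height y t j) (n j) (y j) (N j).

Definition wmul (n : box N) : R[i] := \prod_(j < M) wgt q (n j) (N j).

Definition Wmul (p : R) (x : box N) (s : R[i]) : R[i] :=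
  \prod_(j < M) Wgt p (x j) (height x s j) (N j).

Definition Rr (x y : box N) (s t v : R[i]) : R[i] :=
  \sum_(n : box N) Kmul 1 s n x * Kmul v t n y * wmul n.

End Multivariate.

(* Main.v *)
(* Write p = q^(-2) and b = - q^(2N-2s). Up to a prefactor, k_{u,s}(n,x;N) is a
   dual q-Krawtchouk polynomial in base p. As a function of x it is an
   eigenfunction, with eigenvalue p^(-n), of a second-order difference operator
   symmetric with respect to W, so distinct n are orthogonal. The three-term
   recurrence in n gives orthogonality of the rows x = 0 and x > 0 with respect
   to w; together with the q-binomial theorem this fixes all the norms. Since
   the norm on site j does not depend on the height, the nested sum over x
   factorizes from the last site inwards, and the dual relation is the statement
   that a left inverse of a square matrix is a right inverse. In the theorem, the
   two factors of K_{1,s} (resp. K_{v,t}, K_{-v-2,t}) contract to a diagonal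
   factor q^(-2|n|) (resp. q^(2|n|)), which is the one needed by the dual
   orthogonality of the two remaining factors. *)

Require Import Defs.
From HB Require Import structures.
From mathcomp Require Import all_boot all_order all_algebra.
From mathcomp Require Import complex.
From mathcomp Require Import reals sequences exp trigo.
From mathcomp Require Import ring.

Set Implicit Arguments.
Unset Strict Implicit.
Unset Printing Implicit Defensive.

Import Order.TTheory GRing.Theory Num.Theory.

Local Open Scope complex_scope.
Local Open Scope ring_scope.

(** * Elementary identities for q-Pochhammer symbols *)

Section QPochhammer.
Variable F : fieldType.
Implicit Types a p : F.

Lemma qpoch0 a p : qpoch a p 0 = 1.
Proof. by rewrite /qpoch big_ord0. Qed.

Lemma qpochSr a p n : qpoch a p n.+1 = qpoch a p n * (1 - a * p ^+ n).
Proof. by rewrite /qpoch big_ord_recr. Qed.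

Lemma qpochSl a p n : qpoch a p n.+1 = (1 - a) * qpoch (a * p) p n.
Proof.
rewrite /qpoch big_ord_recl expr0 mulr1; congr (_ * _).
by apply: eq_bigr => i _; rewrite lift0 exprS mulrA.
Qed.

Lemma qpoch_neq0 a p n :
  (forall i, (i < n)%N -> a * p ^+ i != 1) -> qpoch a p n != 0.
Proof.
move=> h; rewrite /qpoch prodf_seq_neq0; apply/allP => i _ /=.
by rewrite subr_eq0 eq_sym h.
Qed.

Lemma qpoch_vanish p m n :
  p != 0 -> (m < n)%N -> qpoch (p ^- m) p n = 0.
Proof.
move=> p0 lt_mn; rewrite /qpoch (bigD1 (Ordinal lt_mn)) //=.
by rewrite mulVf ?expf_neq0 // subrr mul0r.
Qed.

Lemma qpoch_shift a p n :
  a != 1 -> qpoch (a * p) p n = qpoch a p n * (1 - a * p ^+ n) / (1 - a).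
Proof.
move=> a1; rewrite -qpochSr qpochSl [RHS]mulrC mulKf //.
by rewrite subr_eq0 eq_sym.
Qed.

End QPochhammer.

(** * q-binomial coefficients and the q-binomial theorem *)

Section QBinomial.
Variables (F : fieldType) (p : F).
Hypothesis p_tors : forall k, (0 < k)%N -> p ^+ k != 1.

Lemma qfact_neq0 n : qpoch p p n != 0.
Proof. by apply: qpoch_neq0 => i _; rewrite -exprS p_tors. Qed.

Lemma qbinom_neq0 N n : qbinom p N n != 0.
Proof. by rewrite mulf_neq0 ?invr_neq0 ?mulf_neq0 ?qfact_neq0. Qed.

Lemma sub1X_neq0 k : (0 < k)%N -> 1 - p ^+ k != 0.
Proof. by move=> k0; rewrite subr_eq0 eq_sym p_tors. Qed.

Lemma qbinom0 N : qbinom p N 0 = 1.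
Proof. by rewrite /qbinom qpoch0 mul1r subn0 divff ?qfact_neq0. Qed.

Lemma qbinomnn N : qbinom p N N = 1.
Proof. by rewrite /qbinom subnn qpoch0 mulr1 divff ?qfact_neq0. Qed.

Lemma qbinomS N n : (n < N)%N ->
  qbinom p N n.+1 = qbinom p N n * (1 - p ^+ (N - n)) / (1 - p ^+ n.+1).
Proof.
move=> lt_nN; rewrite /qbinom -(subnSK lt_nN) !qpochSr -!exprS.
have := sub1X_neq0 (ltn0Sn n); have := sub1X_neq0 (ltn0Sn (N - n.+1)).
have := qfact_neq0 n; have := qfact_neq0 (N - n.+1).
set u := 1 - p ^+ n.+1; set v := 1 - _.
by move=> *; field; do !(apply/andP; split).
Qed.

Lemma qbinom_pascal N n : (n < N)%N ->
  qbinom p N.+1 n.+1 = qbinom p N n + p ^+ n.+1 * qbinom p N n.+1.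
Proof.
move=> lt_nN; rewrite [qbinom p N n.+1]qbinomS // /qbinom subSS.
rewrite [qpoch p p N.+1]qpochSr [qpoch p p n.+1]qpochSr -!exprS.
have h1 := sub1X_neq0 (ltn0Sn n).
have h2 := qfact_neq0 n; have h3 := qfact_neq0 (N - n).
have -> : p ^+ N.+1 = p ^+ n.+1 * p ^+ (N - n).
  by rewrite -exprD addSn subnKC // ltnW.
set u := p ^+ n.+1; set v := p ^+ (N - n).
by field; do !(apply/andP; split).
Qed.

(** Splitting off the factor [1 + z * p] leaves the product for [z * p]; the two resulting sums,
    shifted by one against each other, recombine by the Pascal rule. *)
Lemma qbinom_thm N z :
  \sum_(n < N.+1) z ^+ n * p ^+ 'C(n.+1, 2) * qbinom p N n =
  \prod_(i < N) (1 + z * p ^+ i.+1).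
Proof.
elim: N z => [|N IHN] z.
  by rewrite big_ord_recl !big_ord0 qbinom0 bin_small // !expr0 !mulr1 addr0.
rewrite [RHS]big_ord_recl.
rewrite [X in _ = _ * X](eq_bigr (fun i : 'I_N => 1 + (z * p) * p ^+ i.+1)); last first.
  by move=> i _; rewrite lift0 [p ^+ i.+2]exprS mulrA.
rewrite -IHN mulrDl mul1r {1}[\sum_(n < N.+1) _]big_ord_recl /=.
rewrite [X in _ + _ * X]big_ord_recr /= qbinom0 qbinomnn bin_small //.
rewrite [LHS]big_ord_recl [X in _ + X]big_ord_recr /= qbinom0 qbinomnn bin_small //.
rewrite (eq_bigr (fun i : 'I_N => z * p * ((z * p) ^+ i * p ^+ 'C(i.+1, 2) *
     qbinom p N i) + (z * p) ^+ i.+1 * p ^+ 'C(i.+2, 2) * qbinom p N i.+1));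
  last first.
  move=> i _; rewrite /bump /= add1n qbinom_pascal // ['C(i.+2, 2)]binS bin1.
  by rewrite !exprMn !exprD !exprS; ring.
rewrite big_split /= -mulr_sumr /bump /= add1n ['C(N.+2, 2)]binS bin1.
rewrite !exprMn !exprD !exprS !expr0.
under [X in _ = _ + X + _]eq_bigr do rewrite add1n.
by ring.
Qed.

End QBinomial.

(** * Dual q-Krawtchouk polynomials with generic parameters *)

Section DualQKrawtchouk.
Variables (F : fieldType) (p b : F) (N : nat).
Hypothesis p0 : p != 0.
Hypothesis p_tors : forall k, (0 < k)%N -> p ^+ k != 1.
Hypothesis b0 : b != 0.
Hypothesis b_gen : forall k, b * p ^+ k != 1.

Definition dqk_coef j := p ^+ j / (qpoch (p ^- N) p j * qpoch p p j).
Definition dqk_basis x j := qpoch (p ^- x) p j * qpoch (b * p ^+ x) p j.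

(** The terminating series 3phi2(p^-n, p^-x, b p^x; p^-N, 0; p, p). Terms with [j > min(n, x)]
    vanish, so the common range up to [N] serves all [n] and [x]. *)
Definition dqk (n x : nat) : F :=
  \sum_(j < N.+1) qpoch (p ^- n) p j * dqk_basis x j * dqk_coef j.

Definition dqk_weight (x : nat) : F :=
  (1 - b * p ^+ x.*2) / (1 - b) *
  (qpoch b p x / qpoch (b * p ^+ N.+1) p x) *
  ((- b^-1) ^+ x * p ^- 'C(x.+1, 2) / qpoch (b * p ^+ N)^-1 p N) *
  qbinom p N x.

(** Its reciprocal turns out to be the squared norm of [dqk n]. *)
Definition dqk_dual_weight (n : nat) : F :=
  (- b^-1) ^+ n * p^-1 ^+ 'C(n.+1, 2) * qbinom p^-1 N n.

Lemma pX_neq0 k : p ^+ k != 0. Proof. exact: expf_neq0. Qed.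

Lemma pXV_neq1 k : (0 < k)%N -> p ^- k != 1.
Proof. by move=> k0; rewrite invr_eq1 p_tors. Qed.

Lemma pV_tors k : (0 < k)%N -> p^-1 ^+ k != 1.
Proof. by rewrite exprVn; apply: pXV_neq1. Qed.

Lemma pXVM_neq1 x j : (x != j)%N -> p ^- x * p ^+ j != 1.
Proof.
move=> nxj; rewrite mulrC; apply/eqP => /divr1_eq E.
case: (ltngtP x j) nxj => // [lt_xj|lt_jx] _.
  have /eqP := p_tors (etrans (subn_gt0 _ _) lt_xj); apply.
  apply: (mulfI (pX_neq0 x)).
  by rewrite -exprD subnKC ?mulr1 ?(ltnW lt_xj).
have /eqP := p_tors (etrans (subn_gt0 _ _) lt_jx); apply.
apply: (mulfI (pX_neq0 j)).
by rewrite -exprD subnKC ?mulr1 ?(ltnW lt_jx).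
Qed.

Lemma qpochN_neq0 j : (j <= N)%N -> qpoch (p ^- N) p j != 0.
Proof.
move=> le_jN; apply: qpoch_neq0 => i lt_ij.
by apply: pXVM_neq1; rewrite neq_ltn (leq_trans lt_ij le_jN) orbT.
Qed.

Lemma sub1bX_neq0 k : 1 - b * p ^+ k != 0.
Proof. by rewrite subr_eq0 eq_sym b_gen. Qed.

Lemma sub1XV_neq0 k : (0 < k)%N -> 1 - p ^- k != 0.
Proof. by move=> k0; rewrite subr_eq0 eq_sym pXV_neq1. Qed.

Lemma dqk_coefS j : (j < N)%N ->
  dqk_coef j = dqk_coef j.+1 * p^-1 * (1 - p ^- N * p ^+ j) * (1 - p ^+ j.+1).
Proof.
move=> lt_jN; rewrite /dqk_coef !qpochSr -!exprS.
have h1 := sub1X_neq0 p_tors (ltn0Sn j).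
have h2 := qpochN_neq0 (ltnW lt_jN).
have h3 := qfact_neq0 p_tors j.
have h4 : 1 - p ^- N * p ^+ j != 0.
  by rewrite subr_eq0 eq_sym pXVM_neq1 // neq_ltn lt_jN orbT.
set c := 1 - p ^- N * _ in h4 *; set d := 1 - p ^+ j.+1 in h1 *.
by rewrite exprS; field; do !(apply/andP; split).
Qed.

(* [diff_up], [diff_down], [rec_up], [rec_down] are B(x), D(x), A_n, C_n of
   Koekoek-Lesky-Swarttouw 14.17 (dual q-Krawtchouk), with c = b p^N. *)
Definition diff_up x := (1 - p ^+ x / p ^+ N) * (1 - b * p ^+ x) /
  ((1 - b * p ^+ x.*2) * (1 - b * p ^+ x.*2.+1)).
Definition diff_down x := b * p ^+ x.*2 / (p * p ^+ N) * (1 - p ^+ x) *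
   (1 - b * p ^+ (N + x)) / ((1 - b * p ^+ x.*2 / p) * (1 - b * p ^+ x.*2)).

(** * The difference equation in [x] *)

Lemma dqk_basisS x j : dqk_basis x j.+1 =
  dqk_basis x j * (1 - p ^- x * p ^+ j) * (1 - b * p ^+ x * p ^+ j).
Proof. by rewrite /dqk_basis !qpochSr; ring. Qed.

(** A unit shift of [x] changes both Pochhammer symbols only in their end factors, so the difference
    retains the common factor [dqk_basis x j] and the index drops by one. *)
Lemma dqk_basis_up x j : diff_up x * (dqk_basis x.+1 j.+1 - dqk_basis x j.+1) =
  - (1 - p ^+ j.+1) / p ^+ x.+1 * (1 - p ^+ x / p ^+ N) *
    (1 - b * p ^+ x * p ^+ j) / (1 - b * p ^+ x.*2) * dqk_basis x j.
Proof.
rewrite /dqk_basis [qpoch (p ^- x.+1) p j.+1]qpochSl.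
have -> : p ^- x.+1 * p = p ^- x.
  by rewrite exprS; have := pX_neq0 x; move=> h; field; rewrite h p0.
rewrite [qpoch _ p j.+1 in X in X - _]qpochSr.
rewrite [qpoch (p ^- x) p j.+1]qpochSr [qpoch (b * _) p j.+1 in X in _ - X]qpochSr.
have -> : b * p ^+ x.+1 = b * p ^+ x * p by rewrite exprSr mulrA.
rewrite qpoch_shift // /diff_up.
have := sub1bX_neq0 x; have := sub1bX_neq0 x.*2; have := sub1bX_neq0 x.*2.+1.
rewrite !exprS -addnn exprD.
set P := p ^+ x; have := pX_neq0 x; rewrite -/P.
set Q := p ^+ N; have := pX_neq0 N; rewrite -/Q => hQ hP h1 h2 h3.
set u := qpoch _ _ _; set y := qpoch _ _ _; set J := p ^+ j.
field; do !(apply/andP; split) => //.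
Qed.

Lemma dqk_basis_down x j : diff_down x * (dqk_basis x.-1 j.+1 - dqk_basis x j.+1) =
  - (1 - p ^+ j.+1) * (b * p ^+ x.*2 / (p * p ^+ N)) * (1 - b * p ^+ (N + x)) *
    (1 - p ^- x * p ^+ j) / (1 - b * p ^+ x.*2) * dqk_basis x j.
Proof.
case: x => [|x] /=.
  (* Here [x.-1] is again 0 and both sides vanish: on the right through [1 - p ^- x * p ^+ j] if
     [j = 0], and through [(1; p)_j] otherwise. *)
  rewrite /diff_down /dqk_basis expr0 subrr mulr0 !mul0r.
  case: j => [|j]; first by rewrite expr0 invr1 !mulr1 subrr mulr0 !mul0r.
  by rewrite invr1 qpochSl subrr !mul0r mulr0.
rewrite /dqk_basis [qpoch (b * p ^+ x) p j.+1]qpochSl.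
have -> : b * p ^+ x * p = b * p ^+ x.+1 by rewrite exprSr mulrA.
rewrite [qpoch (b * _) p j.+1]qpochSr [qpoch (p ^- x.+1) p j.+1]qpochSl.
have E : p ^- x.+1 * p = p ^- x.
  by rewrite exprS; have := pX_neq0 x; move=> h; field; rewrite h p0.
rewrite E -[in qpoch (p ^- x) p j.+1]E qpochSr -E qpoch_shift ?pXV_neq1 // /diff_down.
have h1 := sub1bX_neq0 x.*2.+2; have h2 := p_tors (ltn0Sn x).
have h3 := sub1bX_neq0 x.*2.+1.
move: h1 h2 h3; rewrite -[p ^+ x.+1 == 1]subr_eq0.
rewrite !doubleS addnS !exprS exprD -addnn exprD.
set P := p ^+ x; have := pX_neq0 x; rewrite -/P.
set Q := p ^+ N; have := pX_neq0 N; rewrite -/Q => hQ hP h1 h2 h3.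
set u := qpoch _ _ _; set y := qpoch _ _ _; set J := p ^+ j.
by field; rewrite p0 hQ hP h1 h2 h3.
Qed.

(* The difference equation does not hold term by term in the defining sum: its
   j-th defect is [diff_flux n x j.+1 - diff_flux n x j], which telescopes;
   [rec_flux] plays the same role for the recurrence. *)
Definition diff_flux n x j :=
  if j is i.+1 then qpoch (p ^- n) p j * dqk_coef i / p ^+ i * dqk_basis x i else 0.

Lemma dqk_term_diff n x j : (j <= N)%N ->
  qpoch (p ^- n) p j * dqk_coef j *
    (diff_up x * (dqk_basis x.+1 j - dqk_basis x j) + diff_down x * (dqk_basis x.-1 j - dqk_basis x j)) =
  (p ^- n - 1) * (qpoch (p ^- n) p j * dqk_basis x j * dqk_coef j) +
  (diff_flux n x j.+1 - diff_flux n x j).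
Proof.
case: j => [|j] le_jN.
  by rewrite /diff_flux /dqk_basis /= !qpochSr !qpoch0 !expr0 !divr1 !mulr1; ring.
rewrite dqk_basis_up dqk_basis_down /diff_flux dqk_basisS (dqk_coefS le_jN).
rewrite [qpoch _ p j.+2]qpochSr.
set a := qpoch _ _ _; set e := dqk_coef _; set f := dqk_basis _ _.
have := sub1bX_neq0 x.*2.
rewrite !exprS exprD -addnn exprD.
set P := p ^+ x; have := pX_neq0 x; rewrite -/P.
set K := p ^+ n; have := pX_neq0 n; rewrite -/K.
set J := p ^+ j; have := pX_neq0 j; rewrite -/J.
set Q := p ^+ N; have := pX_neq0 N; rewrite -/Q => hQ hJ hK hP h1.
by field; rewrite p0 hQ hP hK hJ h1.
Qed.

Lemma dqk_difference n x : (n <= N)%N ->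
  diff_up x * (dqk n x.+1 - dqk n x) + diff_down x * (dqk n x.-1 - dqk n x) =
  (p ^- n - 1) * dqk n x.
Proof.
move=> le_nN; apply/eqP; rewrite -subr_eq0; apply/eqP.
rewrite /dqk -!sumrB !mulr_sumr -big_split /= -sumrB.
rewrite (eq_bigr (fun j : 'I_N.+1 => diff_flux n x j.+1 - diff_flux n x j)); last first.
  move=> j _; apply: (addrI ((p ^- n - 1) * (qpoch (p ^- n) p j * dqk_basis x j * dqk_coef j))).
  rewrite -dqk_term_diff; last by rewrite -ltnS.
  move: (diff_up x) (diff_down x) (p ^- n) (qpoch _ _ _) => *.
  move: (dqk_basis x j) (dqk_basis x.+1 j) (dqk_basis x.-1 j) (dqk_coef j) => *.
  by ring.
rewrite -(big_mkord predT (fun j => diff_flux n x j.+1 - diff_flux n x j)) telescope_sumr //.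
(* The flux is 0 at [j = 0] by definition, and at [j = N + 1] because [n <= N]. *)
by rewrite /diff_flux qpoch_vanish ?ltnS // !mul0r subrr.
Qed.

(** * The three-term recurrence in [n] *)

Definition rec_up n := 1 - p ^+ n / p ^+ N.
Definition rec_down n := b * (1 - p ^+ n).

Definition rec_flux n x j :=
  if j is i.+1 then qpoch (p ^- n) p i * dqk_coef i / p ^+ i * dqk_basis x j else 0.

Lemma dqk_term_rec n x j : (j <= N)%N ->
  (rec_up n * (qpoch (p ^- n.+1) p j - qpoch (p ^- n) p j) +
   rec_down n * (qpoch (p ^- n.-1) p j - qpoch (p ^- n) p j)) * dqk_basis x j * dqk_coef j =
  - (1 - p ^- x) * (1 - b * p ^+ x) * (qpoch (p ^- n) p j * dqk_basis x j * dqk_coef j) +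
  (rec_flux n x j.+1 - rec_flux n x j).
Proof.
case: j => [|j] le_jN.
  by rewrite /rec_flux /dqk_basis /= !qpochSr !qpoch0 !expr0 !divr1 !mulr1; ring.
rewrite /rec_flux (dqk_coefS le_jN) [dqk_basis x j.+2]dqk_basisS.
have E m : p ^- m.+1 * p = p ^- m.
  by rewrite exprS; have := pX_neq0 m; move=> h; field; rewrite h p0.
have -> : rec_down n * (qpoch (p ^- n.-1) p j.+1 - qpoch (p ^- n) p j.+1) =
   - b * (1 - p ^+ j.+1) * qpoch (p ^- n) p j.+1.
  rewrite /rec_down; case: n => [|n] /=.
    (* At [n = 0] both sides vanish, by [rec_down 0 = 0] and [(1; p)_{j+1} = 0]. *)
    by rewrite expr0 invr1 [qpoch _ _ _]qpochSl !subrr; ring.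
  rewrite -E qpoch_shift ?pXV_neq1 //.
  have h2 := p_tors (ltn0Sn n); move: h2; rewrite -subr_eq0.
  rewrite !exprS; set P := p ^+ n; have := pX_neq0 n; rewrite -/P => hP h2.
  set u := qpoch _ _ _.
  by field; rewrite p0 hP h2.
rewrite [qpoch (p ^- n.+1) p j.+1]qpochSl E qpochSr.
set a := qpoch _ _ _; set e := dqk_coef _; set f := dqk_basis _ _.
rewrite /rec_up !exprS.
set P := p ^+ x; have := pX_neq0 x; rewrite -/P.
set K := p ^+ n; have := pX_neq0 n; rewrite -/K.
set J := p ^+ j; have := pX_neq0 j; rewrite -/J.
set Q := p ^+ N; have := pX_neq0 N; rewrite -/Q => hQ hJ hK hP.
by field; rewrite p0 hQ hP hK hJ.
Qed.

Lemma dqk_recurrence n x : (x <= N)%N ->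
  rec_up n * (dqk n.+1 x - dqk n x) + rec_down n * (dqk n.-1 x - dqk n x) =
  - (1 - p ^- x) * (1 - b * p ^+ x) * dqk n x.
Proof.
move=> le_xN; apply/eqP; rewrite -subr_eq0; apply/eqP.
rewrite /dqk -!sumrB !mulr_sumr -big_split /= -sumrB.
rewrite (eq_bigr (fun j : 'I_N.+1 => rec_flux n x j.+1 - rec_flux n x j)); last first.
  move=> j _; apply: (addrI (- (1 - p ^- x) * (1 - b * p ^+ x) *
    (qpoch (p ^- n) p j * dqk_basis x j * dqk_coef j))).
  rewrite -dqk_term_rec; last by rewrite -ltnS.
  move: (qpoch (p ^- n.+1) _ _) (qpoch (p ^- n.-1) _ _) (qpoch (p ^- n) _ _) => *.
  move: (rec_up n) (rec_down n) (dqk_basis x j) (dqk_coef j) (p ^- x) (p ^+ x) => *.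
  by ring.
rewrite -(big_mkord predT (fun j => rec_flux n x j.+1 - rec_flux n x j)) telescope_sumr //.
(* Here it is [x <= N] that kills the upper flux, through [(p^-x; p)_{N+1}]. *)
by rewrite /rec_flux /dqk_basis (@qpoch_vanish _ p x N.+1) ?ltnS // mul0r mulr0 subrr.
Qed.

(** * Orthogonality of distinct degrees *)

Lemma qpochb_neq0 k x : qpoch (b * p ^+ k) p x != 0.
Proof. by apply: qpoch_neq0 => i _; rewrite -mulrA -exprD. Qed.

Lemma dqk_weight_const_neq0 : qpoch (b * p ^+ N)^-1 p N != 0.
Proof.
apply: qpoch_neq0 => i lt_iN; have := b_gen (N - i).
rewrite -{2}(subnK (ltnW lt_iN)) exprD.
set u := p ^+ (N - i); set v := p ^+ i => h; apply: contra h.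
rewrite invfM invfM mulrA mulfVK ?pX_neq0 // -invfM => /eqP/(congr1 GRing.inv).
by rewrite invrK invr1 => ->.
Qed.

(** Detailed balance between [x] and [x + 1], the source of the symmetry of the difference
    operator. *)
Lemma dqk_weightS x : (x < N)%N ->
  diff_up x * dqk_weight x = diff_down x.+1 * dqk_weight x.+1.
Proof.
move=> lt_xN; rewrite /dqk_weight (qbinomS p_tors lt_xN).
rewrite !qpochSr ['C(x.+2, 2)]binS bin1 exprD /diff_up /diff_down.
have h0 : 1 - b != 0 by have := sub1bX_neq0 0; rewrite expr0 mulr1.
have h1 := sub1bX_neq0 x.*2; have h2 := sub1bX_neq0 x.*2.+1.
have h3 := sub1bX_neq0 x.*2.+2.
have h4 := qpochb_neq0 N.+1 x.
have h5 : 1 - b * p ^+ N.+1 * p ^+ x != 0.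
  by rewrite -mulrA -exprD sub1bX_neq0.
have h6 := dqk_weight_const_neq0.
have h7 := sub1X_neq0 p_tors (ltn0Sn x).
have h8 := pX_neq0 'C(x.+1, 2).
rewrite doubleS addnS.
set c1 := qpoch (_^-1) _ _ in h6 *; set c2 := qpoch (_ * _) _ _ in h4 *.
have -> : p ^+ (N - x) = p ^+ N / p ^+ x.
  by rewrite -[in p ^+ N](subnK (ltnW lt_xN)) exprD mulfK ?pX_neq0.
set T := p ^+ 'C(_, _) in h8 *; set y := qpoch b p x; set k := qbinom _ _ _.
have := pX_neq0 N; have := pX_neq0 x; have := pX_neq0 x.*2.
move: h5 h1 h2 h3 h7.
rewrite !exprS exprD -!addnn exprD.
set P := p ^+ x; set Q := p ^+ N.
move=> h5 h1 h2 h3 h7 h9 h10 h11.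
set w := (- b^-1) ^+ x.
by field; rewrite p0 b0 h0 h1 h2 h3 h4 h5 h6 h7 h8 h10 h11.
Qed.

(** Together with [diff_upN], this confines the operator to [0..N], so that no boundary terms
    arise. *)
Lemma diff_down0 : diff_down 0 = 0.
Proof. by rewrite /diff_down expr0 subrr mulr0 !mul0r. Qed.

Lemma diff_upN : diff_up N = 0.
Proof. by rewrite /diff_up divff ?pX_neq0 // subrr !mul0r. Qed.

(* The operator of [dqk_difference] is symmetric for [dqk_weight], so the
   Casoratian of two of its eigenfunctions telescopes. *)
Lemma dqk_orth n m : (n <= N)%N -> (m <= N)%N -> n != m ->
  \sum_(x < N.+1) dqk n x * dqk m x * dqk_weight x = 0.
Proof.
move=> le_nN le_mN neq_nm.
have neq_eig : p ^- n - p ^- m != 0.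
  rewrite subr_eq0; have := pXVM_neq1 neq_nm; apply: contra => /eqP->.
  by rewrite mulVf ?pX_neq0.
apply: (mulfI neq_eig); rewrite mulr0 mulr_sumr.
pose cas x := if x is y.+1 then diff_up y * dqk_weight y *
   (dqk n y.+1 * dqk m y - dqk n y * dqk m y.+1) else 0.
rewrite (eq_bigr (fun x : 'I_N.+1 => cas x.+1 - cas x)).
  rewrite -(big_mkord predT (fun x => cas x.+1 - cas x)) telescope_sumr //.
  by rewrite /cas diff_upN !mul0r subrr.
move=> [x /=]; rewrite ltnS => le_xN _.
have -> : (p ^- n - p ^- m) * (dqk n x * dqk m x * dqk_weight x) =
  ((p ^- n - 1) * dqk n x * dqk m x - (p ^- m - 1) * dqk m x * dqk n x) *
  dqk_weight x.
  by move: (p ^- n) (p ^- m) (dqk n x) (dqk m x) (dqk_weight x) => *; ring.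
rewrite -!dqk_difference // /cas.
case: x le_xN => [|x] lt_xN /=.
  rewrite diff_down0; move: (dqk n 1) (dqk m 1) (dqk n 0) (dqk m 0) => *.
  by move: (diff_up 0) (dqk_weight 0) => *; ring.
rewrite [diff_up x * _]dqk_weightS //.
move: (dqk n x.+2) (dqk m x.+2) (dqk n x.+1) (dqk m x.+1) => *.
move: (dqk n x) (dqk m x) (diff_up x.+1) (diff_down x.+1) (dqk_weight x.+1) => *.
by ring.
Qed.

(** * The norms, by way of the dual weight *)

Lemma dqk_x0 n : dqk n 0 = 1.
Proof.
rewrite /dqk big_ord_recl big1 ?addr0 => [|j _].
  by rewrite /dqk_basis /dqk_coef /= !qpoch0 expr0 !mulr1 invr1 !mulr1.
by rewrite /dqk_basis lift0 (@qpoch_vanish _ p 0 j.+1) // mul0r mulr0 mul0r.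
Qed.

Lemma dqk_dual_weightS n : (n < N)%N ->
  rec_up n * dqk_dual_weight n = rec_down n.+1 * dqk_dual_weight n.+1.
Proof.
move=> lt_nN; rewrite /dqk_dual_weight (qbinomS pV_tors lt_nN).
have -> : p^-1 ^+ 'C(n.+2, 2) = p^-1 ^+ 'C(n.+1, 2) * p^-1 ^+ n.+1.
  by rewrite binS bin1 exprD.
rewrite /rec_up /rec_down; set T := p^-1 ^+ 'C(_, _).
have h1 := p_tors (ltn0Sn n); move: h1; rewrite -subr_eq0.
have -> : p^-1 ^+ (N - n) = p ^+ n / p ^+ N.
  rewrite exprVn -[in RHS](subnK (ltnW lt_nN)) exprD.
  by rewrite invfM mulrCA divff ?pX_neq0 // mulr1.
rewrite !exprVn !exprS; set w := (- b^-1) ^+ n.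
have := pX_neq0 N; have := pX_neq0 n; set P := p ^+ n; set Q := p ^+ N.
move=> h2 h3 h1; set k := qbinom _ _ _.
by field; rewrite p0 b0 h1 h2 h3.
Qed.

(** As [dqk n 0 = 1], this is orthogonality of the rows 0 and [x]. The recurrence operator is
    symmetric for the dual weight, with eigenvalue 0 on row 0 and a nonzero eigenvalue on row [x],
    so the sum telescopes. *)
Lemma dqk_dual_sum x : (0 < x <= N)%N ->
  \sum_(n < N.+1) dqk_dual_weight n * dqk n x = 0.
Proof.
case/andP=> x_gt0 le_xN.
have neq_eig : - (1 - p ^- x) * (1 - b * p ^+ x) != 0.
  by rewrite mulf_neq0 ?oppr_eq0 ?sub1XV_neq0 ?sub1bX_neq0.
apply: (mulfI neq_eig); rewrite mulr0 mulr_sumr.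
pose flux n := if n is m.+1 then rec_up m * dqk_dual_weight m *
   (dqk m.+1 x - dqk m x) else 0.
rewrite (eq_bigr (fun n : 'I_N.+1 => flux n.+1 - flux n)).
  rewrite -(big_mkord predT (fun n => flux n.+1 - flux n)) telescope_sumr //.
  by rewrite /flux /rec_up divff ?pX_neq0 // subrr !mul0r subrr.
move=> [n /=]; rewrite ltnS => le_nN _.
rewrite mulrCA -dqk_recurrence // /flux.
case: n le_nN => [|n] lt_nN /=.
  rewrite /rec_down expr0 subrr mulr0 mul0r addr0 subr0.
  by rewrite mulrCA mulrA.
rewrite [rec_up n * _]dqk_dual_weightS //.
move: (dqk n.+2 x) (dqk n.+1 x) (dqk n x) => *.
move: (rec_up n.+1) (rec_down n.+1) (dqk_dual_weight n.+1) => *.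
by ring.
Qed.

(** The q-binomial theorem in base [p^-1] at [z = - b^-1] evaluates the sum as the constant in the
    denominator of [dqk_weight 0]. *)
Lemma dqk_dual_mass :
  dqk_weight 0 * \sum_(n < N.+1) dqk_dual_weight n = 1.
Proof.
rewrite /dqk_dual_weight (qbinom_thm pV_tors) /dqk_weight.
rewrite bin_small // !expr0 !qpoch0 !divr1 !mul1r (qbinom0 p_tors) !mulr1.
rewrite divff ?mul1r; last by have := sub1bX_neq0 0; rewrite expr0 mulr1.
have -> : \prod_(i < N) (1 + - b^-1 * p^-1 ^+ i.+1) = qpoch (b * p ^+ N)^-1 p N.
  rewrite /qpoch -(big_mkord predT (fun i => 1 + - b^-1 * p^-1 ^+ i.+1)).
  rewrite -(big_mkord predT (fun i => 1 - (b * p ^+ N)^-1 * p ^+ i)).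
  (* The factors agree after the reversal [i -> N - 1 - i]. *)
  rewrite [RHS]big_nat_rev /=; apply: eq_big_nat => i /andP[_ lt_iN].
  rewrite add0n mulNr exprVn invfM -mulrA; congr (1 - _ * _).
  rewrite -[in p ^- N](subnK lt_iN) exprD invfM mulrAC.
  by rewrite mulVf ?pX_neq0 // mul1r.
by rewrite mulVf ?dqk_weight_const_neq0.
Qed.

Lemma dqk_dual_weight_neq0 n : dqk_dual_weight n != 0.
Proof.
rewrite mulf_neq0 ?(qbinom_neq0 pV_tors) //.
by rewrite mulf_neq0 ?expf_neq0 ?oppr_eq0 ?invr_eq0.
Qed.

(** For the norm, the relations of all degrees [k] with [n] are summed against the dual weight:
    summing over [x] first leaves only [k = n], summing over [k] first leaves only [x = 0], where
    the total is 1. *)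
Lemma dqk_orthogonality n m : (n <= N)%N -> (m <= N)%N ->
  \sum_(x < N.+1) dqk n x * dqk m x * dqk_weight x =
  (n == m)%:R / dqk_dual_weight n.
Proof.
move=> le_nN le_mN; have [<-|neq_nm] := eqVneq n m; last first.
  by rewrite dqk_orth // mul0r.
rewrite mul1r; apply: (mulfI (dqk_dual_weight_neq0 n)).
rewrite divff ?dqk_dual_weight_neq0 //.
transitivity (\sum_(k < N.+1) dqk_dual_weight k *
    \sum_(x < N.+1) dqk k x * dqk n x * dqk_weight x).
  rewrite [RHS](bigD1 (Ordinal (leq_ltn_trans le_nN (ltnSn N)))) //=.
  rewrite [X in _ = _ + X]big1 ?addr0 // => k neq_kn.
  by rewrite dqk_orth ?mulr0 // -ltnS.
under eq_bigr do rewrite mulr_sumr.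
rewrite exchange_big /= big_ord_recl [X in _ + X]big1 ?addr0 => [|x _].
  rewrite -[RHS]dqk_dual_mass mulr_sumr; apply: eq_bigr => k _.
  by rewrite !dqk_x0 !mul1r mulrC.
transitivity (dqk n (lift ord0 x) * dqk_weight (lift ord0 x) *
  \sum_(k < N.+1) dqk_dual_weight k * dqk k (lift ord0 x)).
  rewrite mulr_sumr; apply: eq_bigr => k _.
  by rewrite mulrC -!mulrA mulrC -!mulrA [_ * dqk k _]mulrC.
by rewrite dqk_dual_sum ?mulr0 // lift0 ltn_ord.
Qed.

End DualQKrawtchouk.

(** * Linear algebra of orthogonality relations *)

Lemma biorthogonal_sym (F : comUnitRingType) (I : finType) (A B : I -> I -> F) :
  (forall n m, \sum_x A n x * B x m = (n == m)%:R) ->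
  forall x y, \sum_n B x n * A n y = (x == y)%:R.
Proof.
move=> AB x y.
pose mx (C : I -> I -> F) : 'M_#|I| :=
  \matrix_(i, j) C (enum_val i) (enum_val j).
have mxM C D i j : (mx C *m mx D) i j =
    \sum_z C (enum_val i) z * D z (enum_val j).
  rewrite mxE [RHS](reindex (fun k : 'I_#|I| => enum_val k)) /=; last first.
    by exists enum_rank => z _; rewrite ?enum_valK ?enum_rankK.
  by apply: eq_bigr => k _; rewrite !mxE.
have /mulmx1C/matrixP/(_ (enum_rank x) (enum_rank y)) : mx A *m mx B = 1%:M.
  by apply/matrixP => i j; rewrite mxM AB mxE (inj_eq enum_val_inj).
by rewrite mxM mxE !enum_rankK (inj_eq enum_rank_inj).
Qed.

(** Orthogonality of [A] and [A'] collapses the double sum over [n] and [m] to its diagonal; each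
    inner sum brings one factor [w], hence the square. *)
Lemma transfer_orthogonality (F : comRingType) (I J : finType)
    (A A' : I -> J -> F) (W : J -> F) (c w B B' : I -> F) :
  (forall n m, \sum_x A n x * A' m x * W x = (n == m)%:R * c n) ->
  \sum_x (\sum_n A n x * B n * w n) * (\sum_m A' m x * B' m * w m) * W x =
  \sum_n c n * w n ^+ 2 * B n * B' n.
Proof.
move=> orth.
transitivity (\sum_x \sum_n \sum_m
    B n * w n * (B' m * w m) * (A n x * A' m x * W x)).
  apply: eq_bigr => x _; rewrite big_distrlr /= mulr_suml.
  apply: eq_bigr => n _; rewrite mulr_suml.
  by apply: eq_bigr => m _; ring.
rewrite exchange_big /=; apply: eq_bigr => n _.
rewrite exchange_big /= (bigD1 n) //= [X in _ + X]big1 => [|m neq_mn].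
  by rewrite -mulr_sumr orth eqxx addr0 mul1r; ring.
by rewrite -mulr_sumr orth eq_sym (negPf neq_mn) mul0r mulr0.
Qed.

(** * Sums over a box of products with triangular dependence *)

Section NestedSum.
Variables (F : comRingType) (M : nat) (N : 'I_M -> nat).
Implicit Type x : box N.

Definition box_upd x (j : 'I_M) (a : 'I_(N j).+1) : box N :=
  [ffun i => dfwith x a i].

Lemma box_upd_in x j a : @box_upd x j a j = a.
Proof. by rewrite ffunE dfwith_in. Qed.

Lemma box_upd_out x j a i : j != i -> @box_upd x j a i = x i.
Proof. by move=> ne; rewrite ffunE dfwith_out. Qed.

(* The factor [f j] may depend on the coordinates up to [j], but its sum over
   the coordinate [j] does not, so the sum is evaluated from the last
   coordinate inwards; [box_below k] freezes the coordinates from [k] on. *)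
Definition box_below (k : nat) : {pred box N} :=
  [pred x : box N | [forall i : 'I_M, (k <= i)%N ==> (x i == ord0)]].

Lemma nested_box_sum (f : 'I_M -> box N -> F) (g : 'I_M -> F) :
  (forall (j : 'I_M) x x', (forall i : 'I_M, (i <= j)%N -> x i = x' i) ->
     f j x = f j x') ->
  (forall j x, \sum_a f j (box_upd x (j := j) a) = g j) ->
  \sum_x \prod_j f j x = \prod_j g j.
Proof.
move=> f_prefix f_sum.
(* Induction on the number [k] of summed coordinates, the others being set to 0. *)
suff H k : (k <= M)%N ->
    \sum_(x in box_below k) \prod_(j < M | (j < k)%N) f j x =
    \prod_(j < M | (j < k)%N) g j.
  have := H M (leqnn M).
  rewrite [RHS](eq_bigl predT) => [<-|j]; last exact: ltn_ord.
  apply: eq_big => [x|x _].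
    by apply/esym/forallP => i; rewrite leqNgt ltn_ord.
  by apply: eq_bigl => j; rewrite ltn_ord.
elim: k => [|k IHk] lt_kM.
  pose x0 : box N := [ffun i => ord0].
  rewrite [RHS]big_pred0 // (big_pred1 x0) => [|x] /=.
    by rewrite big_pred0.
  apply/forallP/eqP => [h|-> i]; last by rewrite ffunE.
  by apply/ffunP => i; rewrite ffunE; apply/eqP/h.
pose K := Ordinal lt_kM.
have split_last (h : 'I_M -> F) : \prod_(j < M | (j < k.+1)%N) h j =
    \prod_(j < M | (j < k)%N) h j * h K.
  rewrite (bigD1 K) ?ltnSn //= mulrC; congr (_ * _); apply: eq_bigl => j.
  by rewrite ltnS -val_eqE /= [RHS]ltn_neqAle andbC.
rewrite split_last -(IHk (ltnW lt_kM)) mulr_suml.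
(* The fibre over [y] consists of the updates of [y] at coordinate [k]; on it the factors before [k]
   are constant. *)
rewrite (partition_big (fun x => box_upd x (j := K) ord0) (box_below k)) /=;
  last first.
  move=> x /forallP h; apply/forallP => i; apply/implyP => le_ki.
  have [<-|neq] := eqVneq K i; first by rewrite box_upd_in.
  rewrite box_upd_out //; apply: (implyP (h i)).
  by rewrite ltn_neqAle le_ki andbT -[k]/(val K) val_eqE.
apply: eq_bigr => y /forallP y_below.
have yK a : box_upd (box_upd y (j := K) a) (j := K) ord0 = y.
  apply/ffunP => i; have [<-|neq] := eqVneq K i.
    by rewrite box_upd_in (eqP (implyP (y_below K) _)).
  by rewrite !box_upd_out.
rewrite (reindex (fun a : 'I_(N K).+1 => box_upd y (j := K) a)) /=.
  rewrite -(f_sum K y) mulr_sumr; apply: eq_big => [a|a _].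
    rewrite yK eqxx andbT; apply/forallP => i; apply/implyP => lt_ki.
    have neq : K != i by rewrite -val_eqE /= neq_ltn lt_ki.
    by rewrite box_upd_out //; apply: (implyP (y_below i)); apply: ltnW.
  rewrite split_last; congr (_ * _); apply: eq_bigr => j lt_jk.
  apply: f_prefix => i le_ij; rewrite box_upd_out //.
  by rewrite -val_eqE /= neq_ltn (leq_ltn_trans le_ij lt_jk) orbT.
exists (fun x => x K) => [a _|x /andP[_ /eqP <-]]; first by rewrite box_upd_in.
apply/ffunP => i; have [<-|neq] := eqVneq K i; first by rewrite box_upd_in.
by rewrite !box_upd_out.
Qed.

End NestedSum.

(** * Complex powers of a real base *)

Local Notation "p ^^ z" := (cpow p z) (at level 30, right associativity).

Section ComplexPower.
Variable R : realType.
Implicit Types (q x : R) (z w : R[i]).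

Lemma cexpD z w : cexp (z + w) = cexp z * cexp w.
Proof.
case: z w => [a b] [c d]; rewrite /cexp /= expRD cosD sinD.
by apply/eqP; rewrite eq_complex /=; apply/andP; split; apply/eqP; ring.
Qed.

Lemma cexp_real x : cexp x%:C = (expR x)%:C.
Proof. by rewrite /cexp /= cos0 sin0 mulr1 mulr0. Qed.

Lemma cexp_conj z : (cexp z)^* = cexp z^*.
Proof. by case: z => a b; rewrite /cexp /= cosN sinN mulrN. Qed.

Lemma cpowD q z w : q ^^ (z + w) = q ^^ z * q ^^ w.
Proof. by rewrite /cpow mulrDl cexpD. Qed.

Lemma cpow0 q : q ^^ 0 = 1.
Proof. by rewrite /cpow mul0r cexp_real expR0. Qed.

Lemma cpowN q z : q ^^ (- z) = (q ^^ z)^-1.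
Proof.
have h : q ^^ (- z) * q ^^ z = 1 by rewrite -cpowD addNr cpow0.
have z0 : q ^^ z != 0.
  by apply: contra_eq_neq h => ->; rewrite mulr0 eq_sym oner_neq0.
by apply: (mulIf z0); rewrite h mulVf.
Qed.

Lemma cpow_neq0 q z : q ^^ z != 0.
Proof.
apply/eqP => h; have := cpowD q z (- z).
by rewrite addrN cpow0 h mul0r => /eqP; rewrite oner_eq0.
Qed.

Lemma cpowX q (n : nat) z : (q ^^ z) ^+ n = q ^^ (n%:R * z).
Proof.
elim: n => [|n IHn]; first by rewrite mul0r cpow0 expr0.
by rewrite exprS IHn -cpowD -natr1 mulrDl mul1r addrC.
Qed.

Lemma cpow_conj q z : (q ^^ z)^* = q ^^ z^*.
Proof.
rewrite /cpow cexp_conj rmorphM; congr (cexp (_ * _)); exact: conjc_real.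
Qed.

Lemma cpow_real q x : q ^^ x%:C = (expR (x * ln q))%:C.
Proof. by rewrite /cpow -rmorphM cexp_real. Qed.

Lemma cpowVl q z : 0 < q -> q^-1 ^^ z = q ^^ (- z).
Proof. by move=> q0; rewrite /cpow lnV // rmorphN mulrN mulNr. Qed.

Lemma cpow_real_neq1 q x : 0 < q -> q != 1 -> x != 0 -> q ^^ x%:C != 1.
Proof.
move=> q0 q1 x0; rewrite cpow_real -(rmorph1 (real_complex R)).
rewrite (inj_eq (@complexI _)) -expR0 (inj_eq (@expR_inj _)).
by rewrite mulf_neq0 ?ln_eq0.
Qed.

(** The value is a negative real; for real [s] this keeps every [1 - b * p ^+ k] away from 0. *)
Lemma Ncpow_real_neq1 q x : - q ^^ x%:C != 1.
Proof.
rewrite cpow_real -rmorphN -(rmorph1 (real_complex R)).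
rewrite (inj_eq (@complexI _)) lt_eqF //.
by rewrite (lt_trans _ ltr01) // oppr_lt0 expR_gt0.
Qed.

End ComplexPower.

(** * Single-site functions as dual q-Krawtchouk polynomials *)

Section SingleSite.
Variables (R : realType) (q : R) (sigma : R).
Hypotheses (q_gt0 : 0 < q) (q_neq1 : q != 1).
Local Notation p := (q ^^ (- 2)).
Local Notation s := (sigma%:C).
Local Notation b N := (- q ^^ (2 * N%:R - 2 * s)).
Variable N : nat.

Lemma base_tors k : (0 < k)%N -> p ^+ k != 1.
Proof.
move=> k_gt0; rewrite cpowX.
have -> : k%:R * - 2 = (- (k%:R * 2))%:C :> R[i].
  by rewrite rmorphN rmorphM !rmorph_nat mulrN.
by rewrite cpow_real_neq1 // oppr_eq0 mulf_neq0 // pnatr_eq0 -?lt0n.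
Qed.

Lemma node_gen k : b N * p ^+ k != 1.
Proof.
rewrite cpowX mulNr -cpowD.
have -> : 2 * N%:R - 2 * s + k%:R * - 2 =
    (2 * N%:R - 2 * sigma + k%:R * - 2)%:C :> R[i].
  by rewrite !(rmorphN, rmorphM, rmorphD, rmorph_nat).
exact: Ncpow_real_neq1.
Qed.

Lemma node_neq0 : b N != 0.
Proof. by rewrite oppr_eq0 cpow_neq0. Qed.

Lemma base_neq0 : p != 0. Proof. exact: cpow_neq0. Qed.

(** Beyond [min(n, x)] one of [(p^-n; p)_j] and [(p^-x; p)_j] vanishes, which extends the sum to
    [N]. *)
Lemma krav_dqk u n x : (n <= N)%N -> (x <= N)%N ->
  krav q u s n x N =
  (-1) ^+ n * q ^^ (n%:R * (s - u - 2^-1 * N%:R + 2^-1)) * dqk p (b N) N n x.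
Proof.
move=> le_nN le_xN; rewrite /krav; congr (_ * _).
have Xn k : q ^^ (2 * k%:R) = p ^- k.
  by rewrite cpowX -cpowN; congr cpow; ring.
rewrite !Xn /dqk.
have le_min : ((minn n x).+1 <= N.+1)%N by rewrite ltnS geq_min le_nN.
rewrite (big_ord_widen _ (fun j => qpochs [:: p ^- n; p ^- x;
  - q ^^ (- 2 * x%:R - 2 * s + 2 * N%:R)] p j /
    qpochs [:: p ^- N; p] p j * q ^^ (- 2 * j%:R)) le_min).
rewrite big_mkcond /=; apply: eq_bigr => j _.
rewrite ltnS leq_min /qpochs !big_cons !big_nil !mulr1 /dqk_basis /dqk_coef.
case: ifP => [_|/negbT].
  have -> : - q ^^ (- 2 * x%:R - 2 * s + 2 * N%:R) = b N * p ^+ x.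
    by rewrite cpowX [RHS]mulNr -cpowD; congr (- cpow _ _); ring.
  rewrite [- 2 * j%:R]mulrC -cpowX.
  by rewrite !mulrA [_ * p ^+ j]mulrAC.
rewrite negb_and -!ltnNge => /orP[] lt_j.
  by rewrite (@qpoch_vanish _ p n j) ?base_neq0 // !mul0r.
by rewrite (@qpoch_vanish _ p x j) ?base_neq0 // !(mul0r, mulr0).
Qed.

(** Matches the quadratic exponents of [Wgt] and [wgt] with powers of [p] to binomial
    coefficients. *)
Lemma binS2 n : n%:R * (n%:R + 1) = 2 * 'C(n.+1, 2)%:R :> R[i].
Proof.
elim: n => [|n IHn]; first by rewrite mul0r bin_small // mulr0.
have -> : 'C(n.+2, 2) = ('C(n.+1, 2) + n.+1)%N by rewrite binS bin1.
by rewrite (natrD _ 'C(n.+1, 2)) [RHS]mulrDr -IHn -natr1; ring.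
Qed.

(** The square of the base [q^-1] is [p], and the two sides then agree factor by factor. *)
Lemma Wgt_dqk x : Wgt q^-1 x s N = dqk_weight p (b N) N x.
Proof.
rewrite /Wgt /dqk_weight !cpowVl //.
congr (_ / _ * (qpoch _ _ _ / qpoch _ _ _) * (_ / qpoch _ _ _) * _).
- rewrite cpowX mulNr opprK -cpowD; congr (1 + cpow _ _).
  by rewrite -muln2 natrM; ring.
- by rewrite opprK; congr (1 + cpow _ _); ring.
- by congr (- cpow _ _); ring.
- by rewrite cpowX mulNr -cpowD; congr (- cpow _ _); rewrite -natr1; ring.
- rewrite invrN opprK -cpowN !cpowX -cpowN -cpowD; congr cpow.
  have := binS2 x; set c := 'C(_, _)%:R => h.
  by have -> : - (c * - 2) = 2 * c; [ring|rewrite -h; ring].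
- by rewrite cpowX [in RHS]mulNr invrN -cpowD -cpowN; congr (- cpow _ _); ring.
Qed.

(** The extra power of [q] carries all the dependence on [s]; the prefactors of two [krav] supply
    the same power. *)
Lemma wgt_dqk n :
  q ^^ (n%:R * (2 * s - N%:R + 1)) * wgt q n N = dqk_dual_weight p (b N) N n.
Proof.
rewrite /wgt /dqk_dual_weight mulrA -[p^-1]cpowN opprK; congr (_ * _).
rewrite invrN opprK -cpowN !cpowX -!cpowD; congr cpow.
have := binS2 n; set c := 'C(_, _)%:R => h.
by rewrite [c * 2]mulrC -h; ring.
Qed.

Lemma wgt_neq0 n : wgt q n N != 0.
Proof.
have := dqk_dual_weight_neq0 N base_neq0 base_tors node_neq0 n.
by rewrite -wgt_dqk mulf_eq0 negb_or => /andP[].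
Qed.

(** The dependence on [s] cancels between the prefactors and the dual weight, so the norm is free of
    the height; the nested summation rests on this. *)
Lemma krav_orthogonality u u' n m : (n <= N)%N -> (m <= N)%N ->
  \sum_(x < N.+1) krav q u s n x N * krav q u' s m x N * Wgt q^-1 x s N =
  (n == m)%:R * (q ^^ (- (u + u') * n%:R) / wgt q n N).
Proof.
move=> le_nN le_mN.
pose pre v k := (-1) ^+ k * q ^^ (k%:R * (s - v - 2^-1 * N%:R + 2^-1)).
rewrite (eq_bigr (fun x : 'I_N.+1 => pre u n * pre u' m *
    (dqk p (b N) N n x * dqk p (b N) N m x * dqk_weight p (b N) N x))); last first.
  move=> x _; have le_xN : (x <= N)%N by rewrite -ltnS.
  rewrite (krav_dqk u le_nN le_xN) (krav_dqk u' le_mN le_xN) Wgt_dqk.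
  rewrite -/(pre u n) -/(pre u' m).
  move: (pre u n) (pre u' m) (dqk _ _ _ n x) (dqk _ _ _ m x) (dqk_weight _ _ _ _).
  by move=> *; ring.
rewrite -mulr_sumr.
rewrite (dqk_orthogonality base_neq0 base_tors node_neq0 node_gen le_nN le_mN).
have [<-|_] := eqVneq n m; last by rewrite !mul0r mulr0.
rewrite !mul1r -wgt_dqk invfM mulrA; congr (_ / _).
rewrite /pre mulrACA -expr2 sqrr_sign mul1r -cpowN -!cpowD; congr cpow.
by field.
Qed.

End SingleSite.

(** * Compatibility with field morphisms, for complex conjugation *)

Section QPochhammerMorphism.
Variables (F F' : fieldType) (f : {rmorphism F -> F'}).

Lemma qpoch_rmorph a p n : f (qpoch a p n) = qpoch (f a) (f p) n.
Proof.
rewrite /qpoch rmorph_prod; apply: eq_bigr => i _.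
by rewrite rmorphB rmorph1 rmorphM rmorphXn.
Qed.

Lemma qpochs_rmorph l p n : f (qpochs l p n) = qpochs (map f l) (f p) n.
Proof.
rewrite /qpochs rmorph_prod big_map; apply: eq_bigr => a _.
exact: qpoch_rmorph.
Qed.

End QPochhammerMorphism.

(** * Multivariate orthogonality, its dual, and conjugation *)

Section MultivariateOrthogonality.
Variables (R : realType) (q : R) (M : nat) (N : 'I_M -> nat).
Hypotheses (q_gt0 : 0 < q) (q_neq1 : q != 1).
Implicit Types (x y n m : box N) (s t : R) (u v : R[i]).

(** A real-valued copy of [height], since the single-site results take a real parameter. *)
Definition heightR y t (k : nat) : R :=
  t + \sum_(i < M | (i < k)%N) (2 * (y i)%:R - (N i)%:R).

Lemma height_real y t k : height y t%:C k = (heightR y t k)%:C.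
Proof.
rewrite /height /heightR rmorphD rmorph_sum /=; congr (_ + _).
by apply: eq_bigr => i _; rewrite rmorphB rmorphM !rmorph_nat.
Qed.

Lemma eq_height x y u k :
  (forall i : 'I_M, (i < k)%N -> x i = y i) -> height x u k = height y u k.
Proof. by move=> xy; congr (_ + _); apply: eq_bigr => i /xy ->. Qed.

Definition degree n : nat := \sum_j n j.

Lemma wmul_neq0 n : wmul q n != 0.
(* [wgt] involves no height, so the parameter value 0 is arbitrary. *)
Proof. by apply/prodf_neq0 => j _; apply: (wgt_neq0 0). Qed.

(** The height at site [j] depends only on the coordinates before [j] and the single-site norm on
    none, so [nested_box_sum] applies. *)
Lemma Kmul_orthogonality u u' s n m :
  \sum_x Kmul q u s%:C n x * Kmul q u' s%:C m x * Wmul q^-1 x s%:C =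
  (n == m)%:R * (q ^^ (- (u + u') * (degree n)%:R) / wmul q n).
Proof.
pose f (j : 'I_M) x :=
  krav q u (height x s%:C j) (n j) (x j) (N j) *
  krav q u' (height x s%:C j) (m j) (x j) (N j) *
  Wgt q^-1 (x j) (height x s%:C j) (N j).
pose g (j : 'I_M) : R[i] := (n j == m j :> nat)%:R *
  (q ^^ (- (u + u') * (n j)%:R) / wgt q (n j) (N j)).
transitivity (\sum_x \prod_j f j x).
  by apply: eq_bigr => x _; rewrite /Kmul /Wmul -!big_split.
rewrite (nested_box_sum (g := g)) => [|j x x' xx'|j x].
- rewrite /g !big_split /= prodfV; congr (_ * (_ / _)).
    have [<-|neq] := eqVneq n m; first by rewrite big1 // => j; rewrite eqxx.
    have [j neq_j] : exists j, n j != m j.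
      apply/existsP; apply: contraNT neq; rewrite negb_exists => /forallP h.
      by apply/eqP/ffunP => j; apply/eqP; rewrite -[_ == _]negbK.
    by rewrite (bigD1 j) //= [_ == _]val_eqE (negPf neq_j) mul0r.
  rewrite /degree natr_sum mulr_sumr.
  by elim/big_rec2: _ => [|j a b _ ->]; rewrite ?cpow0 ?cpowD.
- rewrite /f (eq_height _ (y := x')) => [|i lt_ij]; last by rewrite xx' // ltnW.
  by rewrite xx'.
rewrite /f /g -(krav_orthogonality (heightR x s j) q_gt0 q_neq1); first last.
- by rewrite -ltnS.
- by rewrite -ltnS.
apply: eq_bigr => a _; rewrite box_upd_in -height_real.
rewrite (eq_height _ (y := x)) // => i lt_ij.
by rewrite box_upd_out // -val_eqE /= neq_ltn lt_ij orbT.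
Qed.

(** By [Kmul_orthogonality], two square matrices indexed by the box have product 1; the product in
    the other order gives the dual relation. *)
Lemma Kmul_dual_orthogonality u u' s x y :
  \sum_n Kmul q u s%:C n x * Kmul q u' s%:C n y *
     (q ^^ ((u + u') * (degree n)%:R) * wmul q n) =
  (x == y)%:R / Wmul q^-1 x s%:C.
Proof.
pose A n z := Kmul q u s%:C n z * (q ^^ ((u + u') * (degree n)%:R) * wmul q n).
pose B z n := Kmul q u' s%:C n z * Wmul q^-1 z s%:C.
have AB n m : \sum_z A n z * B z m = (n == m)%:R.
  transitivity (q ^^ ((u + u') * (degree n)%:R) * wmul q n *
    \sum_z Kmul q u s%:C n z * Kmul q u' s%:C m z * Wmul q^-1 z s%:C).
    by rewrite mulr_sumr; apply: eq_bigr => z _; rewrite /A /B; ring.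
  rewrite Kmul_orthogonality mulrCA -[RHS]mulr1; congr (_ * _).
  rewrite mulNr cpowN mulrACA divff ?cpow_neq0 // divff ?wmul_neq0 ?mulr1 //.
have BA := biorthogonal_sym AB.
have WE z z' : Wmul q^-1 z s%:C *
  (\sum_n Kmul q u s%:C n z' * Kmul q u' s%:C n z *
     (q ^^ ((u + u') * (degree n)%:R) * wmul q n)) = (z == z')%:R.
  rewrite -BA mulr_sumr; apply: eq_bigr => n _; rewrite /A /B; ring.
(* On the diagonal the weight times a sum equals 1, so the weight is nonzero. *)
have W0 : Wmul q^-1 x s%:C != 0.
  by apply: contra_eq_neq (WE x x) => ->; rewrite mul0r eqxx eq_sym oner_neq0.
apply: (mulfI W0); rewrite mulrCA divff // mulr1.
have [<-|neq] := eqVneq x y; first by rewrite WE eqxx.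
have W0y : Wmul q^-1 y s%:C != 0.
  by apply: contra_eq_neq (WE y y) => ->; rewrite mul0r eqxx eq_sym oner_neq0.
(* [WE] carries the weight of its first argument, so the wanted sum appears at [(y, x)] with the
   weight of [y]. *)
have := WE y x; rewrite eq_sym (negPf neq) => /eqP.
by rewrite mulf_eq0 (negPf W0y) /= => /eqP ->; rewrite mulr0.
Qed.

Lemma real_complex_conj s : (s%:C)^* = s%:C.
Proof. exact: conjc_real. Qed.

(** With [q] and [s] real, conjugation acts on [u] alone. *)
Lemma krav_conj u s k l L : (krav q u s%:C k l L)^* = krav q u^* s%:C k l L.
Proof.
rewrite /krav rmorphM [X in X * _]rmorphM rmorphXn rmorphN rmorph1 /= cpow_conj.
rewrite rmorph_sum /=.
congr (_ * cpow _ _ * _).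
  rewrite !(rmorph_nat, rmorphM, rmorphD, rmorphN, fmorphV) /=.
  by rewrite real_complex_conj.
apply: eq_bigr => j _.
rewrite !rmorphM fmorphV !qpochs_rmorph /= !(cpow_conj, rmorphN) /= !cpow_conj.
rewrite !(rmorph_nat, rmorphM, rmorphD, rmorphN) /=.
by rewrite real_complex_conj.
Qed.

Lemma wgt_conj k L : (wgt q k L)^* = wgt q k L.
Proof.
rewrite /wgt /qbinom !(rmorphM, fmorphV) /= !qpoch_rmorph /= !cpow_conj.
by rewrite !(rmorphM, rmorphB, rmorph_nat).
Qed.

Lemma Kmul_conj u s n x : (Kmul q u s%:C n x)^* = Kmul q u^* s%:C n x.
Proof.
rewrite /Kmul rmorph_prod; apply: eq_bigr => j _.
by rewrite height_real /= krav_conj.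
Qed.

Lemma Rr_conj x y s t v :
  (Rr q x y s%:C t%:C v)^* = Rr q x y s%:C t%:C v^*.
Proof.
rewrite /Rr rmorph_sum; apply: eq_bigr => n _.
rewrite !rmorphM /= !Kmul_conj rmorph1; congr (_ * _).
by rewrite /wmul rmorph_prod; apply: eq_bigr => j _; rewrite /= wgt_conj.
Qed.

(** Puts the factor in [y] first, as needed to contract over [y] with [transfer_orthogonality]. *)
Lemma Rr_sym x y s t v : Rr q x y s%:C t%:C v =
  \sum_n Kmul q v t%:C n y * Kmul q 1 s%:C n x * wmul q n.
Proof. by apply: eq_bigr => n _; congr (_ * _); apply: mulrC. Qed.

(** The parameters [v] and [- v - 2] add up to [-2], opposite to the sum [1 + 1] from the two
    factors [K_{1,s}]. *)
Lemma Rr_conj_reflect x y s t v :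
  (Rr q x y s%:C t%:C (- v^* - 2))^* = Rr q x y s%:C t%:C (- v - 2).
Proof.
by rewrite Rr_conj; congr Rr; rewrite rmorphB rmorphN /= conjCK rmorph_nat.
Qed.

Lemma cpow_degree_wmul u n :
   q ^^ (- u * (degree n)%:R) / wmul q n * wmul q n ^+ 2 =
   q ^^ (- u * (degree n)%:R) * wmul q n.
Proof. by rewrite expr2 mulrA divfK ?wmul_neq0. Qed.

End MultivariateOrthogonality.

(** * Contraction of two kernels [Rr] over [x] and over [y] *)

Theorem proposition3p15 (R : realType) (q : R) (M : nat) (N : 'I_M -> nat)
    (s t : R) (v : R[i]) (q_gt0 : 0 < q) (q_neq1 : q != 1)
    (M_ge1 : (1 <= M)%N) :
  (forall y y' : box N,
     \sum_(x : box N)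
        Rr q x y s%:C t%:C v * (Rr q x y' s%:C t%:C (- v^* - 2))^* *
        Wmul q^-1 x s%:C
     = (y == y')%:R / Wmul q^-1 y t%:C) /\
  (forall x x' : box N,
     \sum_(y : box N)
        Rr q x y s%:C t%:C v * (Rr q x' y s%:C t%:C (- v^* - 2))^* *
        Wmul q^-1 y t%:C
     = (x == x')%:R / Wmul q^-1 x s%:C).
Proof.
split=> [y y'|x x'].
  under eq_bigr do rewrite Rr_conj_reflect /Rr.
  rewrite (transfer_orthogonality _ _ _ (Kmul_orthogonality q_gt0 q_neq1 1 1 s)).
  rewrite -(Kmul_dual_orthogonality q_gt0 q_neq1 v (- v - 2) t).
  (* The norm of [K_{1,s}] cancels one of the two factors [wmul]; what is left is the dual weight
     for the parameters [v] and [- v - 2]. *)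
  apply: eq_bigr => n _; rewrite cpow_degree_wmul //.
  have -> : v + (- v - 2) = - (1 + 1) by ring.
  by rewrite -mulrA mulrC.
under eq_bigr do rewrite Rr_conj_reflect !Rr_sym.
rewrite (transfer_orthogonality _ _ _ (Kmul_orthogonality q_gt0 q_neq1 v (- v - 2) t)).
rewrite -(Kmul_dual_orthogonality q_gt0 q_neq1 1 1 s).
(* Here the norm of the [K_{v,t}], [K_{-v-2,t}] pair leaves the dual weight for the parameters 1 and
   1. *)
apply: eq_bigr => n _; rewrite cpow_degree_wmul //.
have -> : - (v + (- v - 2)) = 1 + 1 by ring.
by rewrite -mulrA mulrC.
Qed.
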